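(* Let $F$ be a field of characteristic zero, $f$ an anti-involution of $F^\times$, and $\Phi_f(G)=(G,F^\times,\varphi,f)$ a skew gain graph whose underlying graph $G$ is a bipartite graph of order $n$. Then $$\Psi(\Phi_f(G),x)=x^n+\sum_{k=1}^{\lfloor n/2\rfloor}a_{2k}x^{n-2k},$$ where $$a_{2k}=\sum_{L\in\mathfrak{L}_{2k}}(-1)^{K(L)}\Big(\prod_{K_2\text{-components } uv\text{ of }L}g(\varphi(\overrightarrow{uv}))\Big)\prod_{\text{cycle components } C\text{ of }L}\big(\varphi(C)+f(\varphi(C))\big),$$ $\mathfrak{L}_{2k}$ being the set of elementary subgraphs of $G$ of order $2k$ and $K(L)$ the number of components of $L$.
   Context: An anti-involution of $F^\times$ is a map $f:F^\times\to F^\times$ with $f(f(x))=x$ and $f(xy)=f(y)f(x)$. A skew gain graph $(G,F^\times,\varphi,f)$ is a simple graph $G$ with vertices $v_1,\dots,v_n$ and a function $\varphi$ on oriented edges (both orientations of each edge) with values in $F^\times$ satisfying $\varphi(\overrightarrow{vu})=f(\varphi(\overrightarrow{uv}))$. Its adjacency matrix $A$ has $(i,j)$ entry $\varphi(\overrightarrow{v_iv_j})$ if $v_i\sim v_j$ and $0$ otherwise, and $\Psi(\cdot,x)=\det(xI-A)$. $g(x)=xf(x)$. For a cycle $C:v_0v_1\cdots v_kv_0$, $\varphi(C)=\varphi(\overrightarrow{v_0v_1})\cdots\varphi(\overrightarrow{v_kv_0})$. An elementary subgraph is a subgraph each of whose components is $K_2$ or a cycle; its order is its number of vertices. *)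

(* Defs.v *)
From HB Require Import structures.
From mathcomp Require Import all_boot all_order all_algebra.

Set Implicit Arguments.
Unset Strict Implicit.
Unset Printing Implicit Defensive.

Import GRing.Theory.
Local Open Scope ring_scope.

Definition bipartite (T : finType) (e : rel T) : Prop :=
  exists side : T -> bool, forall u v, e u v -> side u != side v.

(* A graph given by its vertex set and its set of edges, an edge being a
   two-element set of vertices. *)
Notation graph T := ({set T} * {set {set T}})%type.

Section Graphs.
Variable T : finType.
Implicit Types (e : rel T) (H L : graph T) (s : seq T).

Definition subgraph e L : bool :=
  [forall d in L.2, d \subset L.1] &&
  (L.2 \subset [set [set u; v] | u in T, v in T & e u v]).

Definition connected_in L : rel T :=
  connect [rel u v | [set u; v] \in L.2].

Definition components L : {set graph T} :=
  [set (X, [set d in L.2 | d \subset X])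
     | X : {set T} in equivalence_partition (connected_in L) L.1].

Definition K2_graph (u v : T) : graph T := ([set u; v], [set [set u; v]]).

(* For s = [:: v0; v1; ...; vk], the cycle v0 v1 ... vk v0. *)
Definition cycle_graph s : graph T :=
  ([set v in s], [set [set v; next s v] | v in s]).

(* s lists the vertices of the cycle H along one traversal of H. *)
Definition traverses s H : bool :=
  [&& (2 < size s)%N, uniq s & H == cycle_graph s].

Definition is_K2 H : bool :=
  [exists u, exists v, (u != v) && (H == K2_graph u v)].

Definition is_cycle H : bool :=
  [exists s : #|H.1|.-tuple T, traverses s H].

Definition elementary_subgraphs e (m : nat) : {set graph T} :=
  [set L | [&& subgraph e L, #|L.1| == m &
             [forall H in components L, is_K2 H || is_cycle H]]].

End Graphs.

(* An anti-involution of the multiplicative group of F is given by a function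
   on F that preserves the nonzero elements; its value at 0 is irrelevant. *)
Definition anti_involution (F : fieldType) (f : F -> F) : Prop :=
  [/\ forall x, x != 0 -> f x != 0,
      forall x, x != 0 -> f (f x) = x &
      forall x y, x != 0 -> y != 0 -> f (x * y) = f y * f x].

(* The value gain u v is only meaningful when u and v are adjacent. *)
Record skew_gain_graph (F : fieldType) (f : F -> F) (n : nat) := SkewGainGraph {
  edge : rel 'I_n;
  edge_sym : symmetric edge;
  edge_irr : irreflexive edge;
  gain : 'I_n -> 'I_n -> F;
  gain_neq0 : forall u v, edge u v -> gain u v != 0;
  gain_rev : forall u v, edge u v -> gain v u = f (gain u v) }.

Section Gains.
Variables (F : fieldType) (f : F -> F) (n : nat) (Phi : skew_gain_graph f n).
Implicit Types (H : graph 'I_n) (s t : seq 'I_n).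

Definition adjacency : 'M[F]_n :=
  \matrix_(i, j) (if edge Phi i j then gain Phi i j else 0).

Definition norm_gain (x : F) : F := x * f x.

(* For s = [:: v0; v1; ...; vk], the product of the gains of v0v1, ..., vkv0. *)
Definition walk_gain s : F := \prod_(v <- s) gain Phi v (next s v).

(* The gain of a K2 component in one of its two orientations; norm_gain of it
   does not depend on which one, by norm_gain_rev below. *)
Definition K2_gain H : F :=
  if [pick p : 'I_n * 'I_n | (p.1 != p.2) && (H == K2_graph p.1 p.2)] is Some p
  then gain Phi p.1 p.2 else 1.

(* The gain of a cycle component along one of its traversals;
   walk_gain_traverses below shows that cycle_gain H + f (cycle_gain H) does
   not depend on which one. *)
Definition cycle_gain H : F :=
  if [pick s : #|H.1|.-tuple 'I_n | traverses s H] is Some s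
  then walk_gain s else 1.

Hypothesis fP : anti_involution f.

Lemma norm_gain_rev u v : edge Phi u v ->
  norm_gain (gain Phi v u) = norm_gain (gain Phi u v).
Proof.
move=> uv; case: fP => _ fK _.
by rewrite /norm_gain (gain_rev uv) fK ?gain_neq0 // mulrC.
Qed.

Lemma anti_involution1 : f 1 = 1.
Proof.
case: fP => f0 _ fM; have f1 := f0 1 (oner_neq0 _).
by apply: (mulfI f1); rewrite -fM ?oner_neq0 // !mulr1.
Qed.

Lemma anti_involution_prod (I : eqType) (r : seq I) (h : I -> F) :
  {in r, forall i, h i != 0} ->
  \prod_(i <- r) f (h i) = f (\prod_(i <- r) h i).
Proof.
case: fP => f0 _ fM; elim: r => [|i r IH] hn.
  by rewrite !big_nil anti_involution1.
rewrite !big_cons IH => [|j jr]; last by apply: hn; rewrite inE jr orbT.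
rewrite fM 1?mulrC ?hn ?mem_head // prodf_seq_neq0.
by apply/allP => j jr; apply: hn; rewrite inE jr orbT.
Qed.

Lemma next_next_neq t x :
  (2 < size t)%N -> uniq t -> x \in t -> next t (next t x) != x.
Proof.
move=> t2 Ut xt; have [i q def] := rot_to xt.
rewrite -!(next_rot i Ut) def.
have: (2 < size (x :: q))%N by rewrite -def size_rot.
have: uniq (x :: q) by rewrite -def rot_uniq.
case: q {def} => [|y [|z q]] //= /and4P[]; rewrite !inE !negb_or eqxx.
by case/and3P=> /negPf xy /negPf xz _ _ _ _ _; rewrite (eq_sym y) xy eqxx eq_sym xz.
Qed.

Lemma walk_gain_traverses s t H : {in s, forall v, edge Phi v (next s v)} ->
  traverses s H -> traverses t H ->
  walk_gain t + f (walk_gain t) = walk_gain s + f (walk_gain s).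
Proof.
move=> es /and3P[s2 Us /eqP->] /and3P[t2 Ut /eqP[V E]].
have mem_st : t =i s by move=> x; move/setP: V => /(_ x); rewrite !inE.
have Pst : perm_eq t s by apply: uniq_perm.
have alt x : x \in t -> (next t x == next s x) || (next s (next t x) == x).
  move=> xt; have: [set x; next t x] \in [set [set v; next s v] | v in s].
    by rewrite E; apply/imsetP; exists x.
  case/imsetP => y ys Exy.
  have: x \in [set y; next s y] by rewrite -Exy set21.
  have: next t x \in [set y; next s y] by rewrite -Exy set22.
  have: next s y \in [set x; next t x] by rewrite Exy set22.
  have: y \in [set x; next t x] by rewrite Exy set21.
  rewrite !inE => /orP[]/eqP yx; first rewrite {}yx.
    move=> /orP[]/eqP sy; last by rewrite sy eqxx.
    by rewrite sy orbb => /eqP ->; rewrite sy eqxx orbT.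
  rewrite -yx => /orP[]/eqP sy; first by move=> _ _; rewrite sy eqxx orbT.
  by rewrite sy !orbb => _ /eqP ->; rewrite sy eqxx orbT.
have all_t (P : pred 'I_n) x : x \in t -> P x ->
    (forall y, y \in t -> P y -> P (next t y)) -> {in t, forall y, P y}.
  move=> xt Px step y yt.
  have /connectP[p] := connect_cycle (cycle_next Ut) xt yt.
  elim: p x xt Px => [|z p IH] x xt Px /=; first by move=> _ ->.
  by case/andP=> /eqP<-; apply: IH; rewrite ?mem_next ?step.
have [x0 x0t] : exists x, x \in t.
  by case: t t2 {V E mem_st Pst alt all_t Ut} => // x t _; exists x; rewrite mem_head.
have gn : {in s, forall v, gain Phi v (next s v) != 0}.
  by move=> v /es/gain_neq0.
have [Px|nPx] := boolP (next t x0 == next s x0).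
  have PA := all_t [pred x | next t x == next s x] _ x0t Px.
  suff -> : walk_gain t = walk_gain s by [].
  rewrite /walk_gain -(perm_big _ Pst) /=; apply: eq_big_seq => x xt.
  congr (gain _ _ _); apply/eqP/PA => // {xt}x xt /= /eqP Px'.
  have := alt (next t x); rewrite mem_next => /(_ xt) /orP[//|/eqP].
  rewrite Px' => /(can_inj (prev_next Us)); rewrite -Px' => /eqP.
  by rewrite (negPf (next_next_neq t2 Ut xt)).
have Qx : next s (next t x0) == x0 by have := alt _ x0t; rewrite (negPf nPx).
have QA : {in t, forall x, next s (next t x) == x}.
  apply: (all_t [pred x | next s (next t x) == x] _ x0t Qx) => x xt /= /eqP Qx'.
  have := alt (next t x); rewrite mem_next => /(_ xt) /orP[|//].
  by rewrite Qx' (negPf (next_next_neq t2 Ut xt)).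
suff -> : walk_gain t = f (walk_gain s).
  case: fP => _ fK _; rewrite fK 1?addrC //.
  by rewrite /walk_gain prodf_seq_neq0; apply/allP.
rewrite /walk_gain -anti_involution_prod //.
have Pn : perm_eq (map (next t) t) s.
  apply: uniq_perm => //; first by rewrite map_inj_uniq //; apply: can_inj (prev_next Ut).
  move=> y; rewrite -mem_st; apply/mapP/idP => [[x xt ->]|yt]; first by rewrite mem_next.
  by exists (prev t y); rewrite ?mem_prev ?next_prev.
rewrite -(perm_big _ Pn) /= big_map; apply: eq_big_seq => x xt.
have xs : next t x \in s by rewrite -mem_st mem_next.
by rewrite -(gain_rev (es _ xs)) (eqP (QA _ xt)).
Qed.

End Gains.

(* Main.v *)
Require Import Defs.
From mathcomp Require Import all_boot all_order all_algebra all_fingroup.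
Import GRing.Theory.
Local Open Scope ring_scope.

Set Implicit Arguments.
Unset Strict Implicit.
Unset Printing Implicit Defensive.

(** In the Leibniz expansion of [det (xI - A)] the permutation [s] contributes
    its weight [sgn s * prod_(s x <> x) - A x (s x)] times [x] to the number of
    fixed points of [s].  The weight vanishes unless the nontrivial orbits of
    [s], drawn as a graph, form an elementary subgraph.  The total weight of the
    permutations drawing a given graph is multiplicative over vertex-disjoint
    unions, so it is enough to compute it on a single component: [K_2] is drawn
    by one transposition only, and a cycle by the two cyclic permutations that
    traverse it in opposite directions; either way a sign [-1] comes out.
    Bipartiteness is needed only to kill the odd terms: a permutation of nonzero
    weight exchanges the two colour classes of the points it moves. *)

(** * The graph drawn by a permutation *)

Section PermGraph.
Variable T : finType.
Implicit Types (s : {perm T}) (L H : graph T).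

Definition moved s : {set T} := [set x | s x != x].

(** Directions are forgotten: a 2-cycle draws a single edge, and a permutation draws the same graph
    as its inverse. *)
Definition perm_graph s : graph T :=
  (moved s, [set [set x; s x] | x in moved s]).

Definition disjoint_union (K : {set graph T}) : graph T :=
  (\bigcup_(H in K) H.1, \bigcup_(H in K) H.2).

(** The half of [subgraph] that does not refer to an ambient graph; it makes disjoint vertex sets
    separate the edges as well. *)
Definition well_formed L := [forall d in L.2, d \subset L.1].

Lemma moved_perm s x : (s x \in moved s) = (x \in moved s).
Proof. by rewrite !inE (inj_eq perm_inj). Qed.

Lemma moved_mul s1 s2 x : [disjoint moved s1 & moved s2] ->
  x \in moved s1 -> (s1 * s2)%g x = s1 x.
Proof.
move=> /disjointFr D xs1; rewrite permM.
by have := D (s1 x); rewrite moved_perm => /(_ xs1); rewrite inE => /negbFE/eqP.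
Qed.

Lemma moved_commute s1 s2 : [disjoint moved s1 & moved s2] ->
  (s1 * s2 = s2 * s1)%g.
Proof.
move=> D; apply/permP=> x.
have D' : [disjoint moved s2 & moved s1] by rewrite disjoint_sym.
have [x1|] := boolP (x \in moved s1).
  rewrite moved_mul // permM.
  by have := disjointFr D x1; rewrite inE => /negbFE/eqP ->.
have [x2|] := boolP (x \in moved s2); last first.
  by rewrite !inE !negbK => /eqP x2 /eqP x1; rewrite !permM x1 x2 x1.
by rewrite inE negbK => /eqP x1; rewrite (moved_mul D') // permM x1.
Qed.

Lemma movedM s1 s2 : [disjoint moved s1 & moved s2] ->
  moved (s1 * s2) = moved s1 :|: moved s2.
Proof.
move=> D; have D' : [disjoint moved s2 & moved s1] by rewrite disjoint_sym.
apply/setP=> x; rewrite in_setU.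
have [x1|] := boolP (x \in moved s1).
  by rewrite [LHS]inE moved_mul //; move: x1; rewrite inE.
have [x2|] := boolP (x \in moved s2).
  rewrite [LHS]inE moved_commute // moved_mul //.
  by move: x2; rewrite inE orbC => ->.
by rewrite !inE !negbK permM => /eqP x2 /eqP ->; rewrite x2 eqxx.
Qed.

Lemma perm_graphM s1 s2 : [disjoint moved s1 & moved s2] ->
  perm_graph (s1 * s2) = (moved s1 :|: moved s2,
     (perm_graph s1).2 :|: (perm_graph s2).2).
Proof.
move=> D; have D' : [disjoint moved s2 & moved s1] by rewrite disjoint_sym.
rewrite /perm_graph movedM // imsetU; congr (_, _ :|: _);
  apply: eq_in_imset => x xs; first by rewrite moved_mul.
by rewrite moved_commute // moved_mul.
Qed.

Lemma well_formed_perm_graph s : well_formed (perm_graph s).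
Proof.
apply/forall_inP => d /imsetP[x xs ->]; apply/subsetP => y.
by rewrite !inE => /orP[]/eqP->; move: xs; rewrite ?(inj_eq perm_inj) !inE.
Qed.

Lemma perm_graphV s : perm_graph s^-1 = perm_graph s.
Proof.
have mV : moved s^-1 = moved s.
  by apply/setP => x; rewrite !inE -(inj_eq (@perm_inj _ s)) permKV eq_sym.
rewrite /perm_graph mV; congr (_, _); apply/setP => d.
apply/imsetP/imsetP => -[x xs ->].
  by exists (s^-1 x)%g; rewrite ?permKV 1?setUC // -mV moved_perm mV.
by exists (s x); rewrite ?permK 1?setUC // moved_perm.
Qed.

Lemma moved_restr_perm (S : {set T}) s : s \in 'N(S | 'P)%g ->
  moved (restr_perm S s) = moved s :&: S.
Proof.
move=> sS; apply/setP => x; rewrite !inE.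
have [xS|xS] := boolP (x \in S); first by rewrite restr_permE // andbT.
by rewrite (out_perm (restr_perm_on S s)) // eqxx andbF.
Qed.

(** At a vertex [x] of [L1] the drawn edge [[set x; s x]] cannot belong to [L2], whose edges avoid
    [x]. So it is an edge of [L1], and [s] never leaves the vertices of [L1]. *)
Lemma perm_graph_restr s L1 L2 : well_formed L1 -> well_formed L2 ->
    [disjoint L1.1 & L2.1] ->
    perm_graph s = (L1.1 :|: L2.1, L1.2 :|: L2.2) ->
  (s \in 'N(L1.1 | 'P)%g) /\ perm_graph (restr_perm L1.1 s) = L1.
Proof.
move=> /forall_inP l1 /forall_inP l2 D [E1 E2].
have edge1 x : x \in L1.1 -> [set x; s x] \in L1.2.
  move=> x1; have: [set x; s x] \in L1.2 :|: L2.2.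
    by rewrite -E2; apply/imset_f; rewrite E1 inE x1.
  rewrite inE => /orP[//|/l2 /subsetP/(_ x)]; rewrite set21 => /(_ isT) x2.
  by rewrite (disjointFr D x1) in x2.
have sN : s \in 'N(L1.1 | 'P)%g.
  apply/astabsP => x; rewrite /= apermE; apply/idP/idP; last first.
    by move/edge1/l1/subsetP; apply; rewrite set22.
  (* Nothing enters [L1.1] from outside either: its image lies in it and has the same
     cardinality. *)
  have: s @: L1.1 = L1.1.
    apply/eqP; rewrite eqEcard card_imset ?leqnn ?andbT; last exact: perm_inj.
    apply/subsetP => _ /imsetP[y y1 ->].
    by move/edge1/l1/subsetP: y1; apply; rewrite set22.
  by move=> {1}<-; rewrite mem_imset //; apply: perm_inj.
split=> //; rewrite /perm_graph moved_restr_perm // E1 setUK.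
rewrite [RHS]surjective_pairing; congr (_, _); apply/setP => d.
apply/imsetP/idP => [[x x1 ->]|d1]; first by rewrite restr_permE ?edge1.
have: d \in L1.2 :|: L2.2 by rewrite inE d1.
rewrite -E2 => /imsetP[x _ dE]; have x1 : x \in L1.1.
  by apply: (subsetP (l1 d d1)); rewrite dE set21.
by exists x; rewrite ?restr_permE.
Qed.

End PermGraph.

(** * Weights and their multiplicativity over disjoint unions *)

Section Weight.
Variables (R : comNzRingType) (T : finType) (A : T -> T -> R).
Implicit Types (s : {perm T}) (L H : graph T).

Definition perm_weight s : R := (-1) ^+ s * \prod_(x in moved s) - A x (s x).

Definition graph_weight L : R := \sum_(s | perm_graph s == L) perm_weight s.

Lemma perm_weightM s1 s2 : [disjoint moved s1 & moved s2] ->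
  perm_weight (s1 * s2) = perm_weight s1 * perm_weight s2.
Proof.
move=> D; have D' : [disjoint moved s2 & moved s1] by rewrite disjoint_sym.
rewrite /perm_weight movedM // odd_permM signr_addb mulrACA; congr (_ * _).
rewrite (eq_bigl _ _ (fun x => in_setU x _ _)) bigU //=; congr (_ * _);
  apply: eq_bigr => x xs.
  by rewrite moved_mul.
by rewrite moved_commute // moved_mul.
Qed.

(** Multiplication is a bijection from the pairs of permutations drawing [L1] and [L2] onto the
    permutations drawing the union. Its inverse restricts a permutation to the two vertex sets. *)
Lemma graph_weightU L1 L2 : well_formed L1 -> well_formed L2 ->
    [disjoint L1.1 & L2.1] ->
  graph_weight (L1.1 :|: L2.1, L1.2 :|: L2.2) =
  graph_weight L1 * graph_weight L2.
Proof.
move=> l1 l2 D.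
have restr s : perm_graph s = (L1.1 :|: L2.1, L1.2 :|: L2.2) ->
    [/\ s \in 'N(L1.1 | 'P)%g, s \in 'N(L2.1 | 'P)%g,
        perm_graph (restr_perm L1.1 s) = L1 &
        perm_graph (restr_perm L2.1 s) = L2].
  move=> E; have [N1 E1] := perm_graph_restr l1 l2 D E.
  have [||//] := perm_graph_restr (s := s) l2 l1; first by rewrite disjoint_sym.
  by rewrite E setUC [_.2 :|: _]setUC.
rewrite /graph_weight big_distrlr /= pair_big /=.
rewrite (reindex_onto (fun p : {perm T} * {perm T} => (p.1 * p.2)%g)
  (fun s => (restr_perm L1.1 s, restr_perm L2.1 s))) /=; last first.
  move=> s /eqP E.
  have [N1 N2 E1 E2] := restr s E.
  apply/permP => x; case: (E) => Em _; rewrite permM.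
  have [x1|x1] := boolP (x \in L1.1).
    rewrite (restr_permE N1 x1) (out_perm (restr_perm_on L2.1 s)) //.
    rewrite (disjointFr D) //.
    by move/astabsP: N1 => /(_ x) /=; rewrite apermE => ->.
  rewrite (out_perm (restr_perm_on L1.1 s)) //.
  have [x2|x2] := boolP (x \in L2.1); first by rewrite restr_permE.
  (* A point outside both vertex sets is not moved by [s]. *)
  rewrite (out_perm (restr_perm_on _ _)) //; apply/esym/eqP.
  have := in_setU x L1.1 L2.1.
  by rewrite -Em (negPf x1) (negPf x2) inE => /negbFE.
have M (s : {perm T}) L : perm_graph s = L -> moved s = L.1 by move<-.
apply: eq_big => [[s1 s2]|[s1 s2]] /=; last first.
  case/andP=> /eqP E /eqP[E1 E2].
  have [N1 N2 E1' E2'] := restr _ E.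
  rewrite E1 in E1'; rewrite E2 in E2'.
  by rewrite perm_weightM // (M _ _ E1') (M _ _ E2').
(* The pairs recovered from their product by restriction, among those whose product draws the union,
   are exactly those drawing [L1] and [L2]. *)
apply/andP/andP => [[/eqP E /eqP[E1 E2]]|[/eqP E1 /eqP E2]].
  have [N1 N2 E1' E2'] := restr _ E.
  by rewrite -{1}E1 E1' -{1}E2 E2'.
have D12 : [disjoint moved s1 & moved s2] by rewrite (M _ _ E1) (M _ _ E2).
have E : perm_graph (s1 * s2) = (L1.1 :|: L2.1, L1.2 :|: L2.2).
  by rewrite perm_graphM // (M _ _ E1) (M _ _ E2) E1 E2.
split; first by rewrite E.
have [N1 N2 E1' E2'] := restr _ E.
rewrite xpair_eqE; apply/andP; split; apply/eqP/permP => x.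
  have [x1|x1] := boolP (x \in L1.1).
    by rewrite restr_permE // moved_mul // (M _ _ E1).
  rewrite (out_perm (restr_perm_on _ _)) //.
  by move: x1; rewrite -(M _ _ E1) inE negbK => /eqP.
have [x2|x2] := boolP (x \in L2.1).
  rewrite (restr_permE N2 x2) moved_commute // moved_mul ?(M _ _ E2) //.
  by rewrite (M _ _ E1) disjoint_sym.
rewrite (out_perm (restr_perm_on _ _)) //.
by move: x2; rewrite -(M _ _ E2) inE negbK => /eqP.
Qed.

(** Only the identity draws the empty graph. This starts the induction over components and also
    yields the leading coefficient of the characteristic polynomial. *)
Lemma graph_weight0 : graph_weight (set0, set0) = 1.
Proof.
have E1 (s : {perm T}) : moved s = set0 -> s = 1%g.
  move=> s0; apply/permP => x; rewrite perm1; apply/eqP; apply: negbFE.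
  by have := in_set0 x; rewrite -s0 inE.
have m1 : moved (1 : {perm T})%g = set0.
  by apply/setP => x; rewrite !inE perm1 eqxx.
rewrite /graph_weight (big_pred1 1%g) => [|s].
  by rewrite /perm_weight m1 big_set0 odd_perm1 mulr1.
apply/eqP/eqP => [[s0 _]|->]; first exact: E1.
by rewrite /perm_graph m1 imset0.
Qed.

(** Induction on the number of graphs, splitting off one of them with [graph_weightU]. *)
Lemma graph_weight_disjoint_union (K : {set graph T}) :
    {in K, forall H, well_formed H} ->
    {in K &, forall H1 H2, H1 != H2 -> [disjoint H1.1 & H2.1]} ->
  graph_weight (disjoint_union K) = \prod_(H in K) graph_weight H.
Proof.
move: {2}#|K| (erefl #|K|) => m.
elim: m K => [|m IH] K cK lK dK.
  by move/cards0_eq: cK => ->; rewrite /disjoint_union !big_set0 graph_weight0.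
have [H HK] : exists H, H \in K by apply/card_gt0P; rewrite cK.
have cK' : #|K :\ H| = m by have := cardsD1 H K; rewrite HK cK => -[].
have lK' : {in K :\ H, forall H1, well_formed H1} by move=> H1 /setD1P[_ /lK].
have dK' : {in K :\ H &, forall H1 H2, H1 != H2 -> [disjoint H1.1 & H2.1]}.
  by move=> H1 H2 /setD1P[_ h1] /setD1P[_ h2]; apply: dK.
rewrite (big_setD1 H HK) /= -(IH _ cK' lK' dK').
rewrite /disjoint_union !(big_setD1 H HK) /= -graph_weightU //=.
- exact: lK.
- apply/forall_inP => d /bigcupP[H1 h1 dH1].
  apply: subset_trans (bigcup_sup H1 h1).
  by case/setD1P: h1 => _ /lK/forall_inP; apply.
- rewrite disjoint_sym disjoints_subset; apply/bigcupsP => H1 /setD1P[n1 h1].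
  by rewrite -disjoints_subset dK.
Qed.

End Weight.

(** * Components, and why a drawn graph is elementary *)

Section Components.
Variable T : finType.
Implicit Types (e : rel T) (s : {perm T}) (L H : graph T).

Lemma edge_set2 e u v : symmetric e ->
  ([set u; v] \in [set [set a; b] | a in T, b in T & e a b]) -> e u v.
Proof.
move=> e_sym /imset2P[a b _]; rewrite inE => /andP[_ ab] E.
have: u \in [set a; b] by rewrite -E set21.
have: v \in [set a; b] by rewrite -E set22.
have: a \in [set u; v] by rewrite E set21.
have: b \in [set u; v] by rewrite E set22.
by rewrite !inE => /orP[] /eqP Eb /orP[] /eqP Ea /orP[] /eqP Ev /orP[] /eqP Eu;
  move: ab {E}; subst => //; rewrite e_sym.
Qed.

Lemma connected_in_partition L :
  partition (equivalence_partition (connected_in L) L.1) L.1.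
Proof.
apply: equivalence_partitionP => x y z _ _ _; split; first exact: connect0.
have C : connect_sym [rel u v | [set u; v] \in L.2].
  by apply: sym_connect_sym => u v /=; rewrite setUC.
by move=> xy; apply: (same_connect C).
Qed.

Lemma well_formed_components L H : H \in components L -> well_formed H.
Proof.
by case/imsetP => X _ ->; apply/forall_inP => d /=; rewrite inE => /andP[].
Qed.

Lemma components_disjoint L : {in components L &, forall H1 H2, H1 != H2 ->
  [disjoint H1.1 & H2.1]}.
Proof.
move=> _ _ /imsetP[X PX ->] /imsetP[Y PY ->] /= XY.
have /and3P[_ /trivIsetP tP _] := connected_in_partition L.
by apply: tP => //; apply: contraNneq XY => ->.
Qed.

(** No edge is lost: the two ends of an edge are connected by that edge, so it lies inside one class
    of the partition. *)
Lemma disjoint_union_components e L :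
  subgraph e L -> disjoint_union (components L) = L.
Proof.
move=> /andP[/forall_inP lL /subsetP eL].
have /and3P[/eqP cP _ _] := connected_in_partition L.
rewrite [RHS]surjective_pairing; congr (_, _); apply/setP => x.
  rewrite -[in RHS]cP; apply/bigcupP/bigcupP.
    by case=> _ /imsetP[X PX ->] xX; exists X.
  case=> X PX xX.
  by exists (X, [set d in L.2 | d \subset X]) => //; apply: imset_f.
apply/bigcupP/idP => [[_ /imsetP[X PX ->]]|xL]; first by rewrite inE => /andP[].
have /imset2P[u v _ _ xE] := eL _ xL.
have uL : u \in L.1 by apply: (subsetP (lL _ xL)); rewrite xE set21.
have vL : v \in L.1 by apply: (subsetP (lL _ xL)); rewrite xE set22.
set X := [set y in L.1 | connected_in L u y].
exists (X, [set d in L.2 | d \subset X]).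
  by apply: imset_f; apply: imset_f.
rewrite inE xL /= xE; apply/subsetP => y; rewrite !inE => /orP[]/eqP->.
  by rewrite uL /= /connected_in connect0.
by rewrite vL; apply: connect1; rewrite /= -xE.
Qed.

Lemma component_edges e L H : subgraph e L -> H \in components L ->
  H.2 \subset [set [set u; v] | u in T, v in T & e u v].
Proof.
move=> /andP[_ eL] /imsetP[X _ ->]; apply: subset_trans eL.
by apply/subsetP => d; rewrite inE => /andP[].
Qed.

Lemma card_K2_graph (u v : T) : u != v -> #|(K2_graph u v).1| = 2.
Proof. by move=> uv; rewrite cards2 uv. Qed.

(** The tuple length in [is_cycle] is no restriction, since a traversal lists each vertex exactly
    once. *)
Lemma is_cycleP H : reflect (exists t, traverses t H) (is_cycle H).
Proof.
rewrite /is_cycle; case: existsP => ex; constructor.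
  by case: ex => t tH; exists t.
case=> t tH; have /and3P[_ Ut /eqP HE] := tH.
have sz : size t == #|H.1|.
  by rewrite HE /= cardsE; apply/eqP/esym/card_uniqP.
by apply: ex; exists (Tuple sz).
Qed.

(** Two vertices against at least three. Hence no component contributes to both products of the
    coefficient formula. *)
Lemma is_K2_not_cycle H : is_K2 H -> is_cycle H = false.
Proof.
case/existsP => u /existsP[v /andP[uv /eqP HE]].
apply/is_cycleP => -[t /and3P[t2 Ut /eqP E]].
have: #|H.1| = size t by rewrite E cardsE; apply/card_uniqP.
by rewrite HE card_K2_graph // => tE; rewrite -tE in t2.
Qed.

(** Undirected paths give nothing beyond forward iteration, because reachability under a permutation
    of a finite set is symmetric. *)
Lemma connected_in_perm_graph s x y :
  connected_in (perm_graph s) x y = fconnect s x y.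
Proof.
have C := fconnect_sym (@perm_inj _ s).
apply/idP/idP; apply: connect_sub => u v /=.
  case/imsetP => z _ E.
  have: u \in [set z; s z] by rewrite -E set21.
  have: v \in [set z; s z] by rewrite -E set22.
  have z1 : fconnect s z (s z) := fconnect1 s z.
  by rewrite !inE => /orP[]/eqP-> /orP[]/eqP->; rewrite ?connect0 // C.
move/eqP <-; have [->|us] := eqVneq (s u) u; first exact: connect0.
by apply: connect1 => /=; apply/imsetP; exists u; rewrite ?inE.
Qed.

(** The component of [x] is the cycle graph of its orbit listed in the order of iteration, where
    [next] agrees with [s]. An orbit of length at least three is a traversal; otherwise its length
    is two, since [x] is moved. *)
Lemma perm_graph_components s H : H \in components (perm_graph s) ->
  is_K2 H || is_cycle H.
Proof.
case/imsetP => X /imsetP[x xs XE] HE.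
set t := fingraph.orbit s x.
(* All points of the orbit are moved, since [x] is moved and [s] is injective. *)
have XtE : X = [set y in t].
  apply/setP => y; rewrite XE 2!inE connected_in_perm_graph -fconnect_orbit inE.
  have [xy|_] := boolP (fconnect s x y); last by rewrite andbF.
  rewrite andbT; have := iter_findex xy; move: (findex s x y) => k <-.
  by elim: k => [|k IH]; [move: xs; rewrite inE | rewrite (inj_eq perm_inj)].
have nextt y : y \in t -> next t y = s y.
  move=> yt; apply/esym/eqP; apply: (@next_cycle _ (frel s)) => //.
  exact: cycle_orbit perm_inj _.
have HtE : H = cycle_graph t.
  rewrite HE XtE; congr (_, _); apply/setP => d; apply/setIdP/imsetP.
    case=> /imsetP[y ys ->] /subsetP/(_ y).
    by rewrite set21 inE => /(_ isT) yt; exists y; rewrite ?nextt.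
  case=> y yt ->; rewrite nextt //; split.
    apply: imset_f; have: y \in X by rewrite XtE inE.
    by rewrite XE inE => /andP[].
  apply/subsetP => z; rewrite !inE => /orP[]/eqP-> //.
  by rewrite -nextt // mem_next.
have Ut : uniq t := fingraph.orbit_uniq s x.
have [t2|t2] := ltnP 2 (size t).
  apply/orP; right; apply/is_cycleP; exists t.
  by rewrite /traverses t2 Ut HtE eqxx.
apply/orP; left; apply/existsP; exists x; apply/existsP; exists (s x).
have sx : s x != x by move: xs; rewrite !inE.
rewrite eq_sym sx /= HtE.
have tE : t = [:: x; s x].
  have xt : x \in t by apply: in_orbit.
  have sxt : s x \in t by rewrite -nextt ?mem_next.
  move: t2 sxt; rewrite /t /fingraph.orbit.
  case: (fingraph.order s x) => [|[|[|k]]] //=.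
  by rewrite inE (negPf sx).
rewrite tE /cycle_graph /K2_graph; apply/eqP; congr (_, _).
  by apply/setP => y; rewrite !inE.
apply/setP => d; rewrite inE; apply/imsetP/eqP => [[y]|->].
  rewrite !inE => /orP[]/eqP-> -> /=; rewrite !eqxx ?(negPf sx) //.
  by rewrite setUC.
by exists x; rewrite ?mem_head //= eqxx.
Qed.

End Components.

(** * The weight of a single edge *)

Lemma graph_weight_K2 (R : comNzRingType) (T : finType) (A : T -> T -> R) u v :
    u != v ->
  graph_weight A (K2_graph u v) = - (A u v * A v u).
Proof.
move=> uv.
have mE : moved (tperm u v) = [set u; v].
  apply/setP => x; rewrite !inE; case: tpermP => [->|->|/eqP xu /eqP xv].
  - by rewrite eq_sym uv eqxx.
  - by rewrite uv eqxx orbT.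
  - by rewrite eqxx (negPf xu) (negPf xv).
rewrite /graph_weight (big_pred1 (tperm u v)) => [|s].
  rewrite /perm_weight mE odd_tperm uv big_setU1 ?inE //= big_set1.
  (* The minus signs of the two factors cancel; the one that stays is the sign of the
     transposition. *)
  by rewrite tpermL tpermR mulrNN expr1 mulN1r.
apply/eqP/eqP => [[Em _]|->]; last first.
  rewrite /perm_graph mE; congr (_, _).
  by rewrite imsetU !imset_set1 tpermL tpermR (setUC [set v]) setUid.
(* A moved point goes to a different point of [[set u; v]], hence to the other end of the edge. *)
apply/permP => x; have [xs|] := boolP (x \in moved s); last first.
  rewrite inE negbK => /eqP sx; rewrite sx.
  have: x \notin moved s by rewrite inE sx eqxx.
  by rewrite Em !inE negb_or => /andP[xu xv]; rewrite tpermD // eq_sym.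
have: s x \in [set u; v] by rewrite -[[set u; v]]Em moved_perm.
have: x \in [set u; v] by rewrite -[[set u; v]]Em.
move: xs; rewrite !inE => sx /orP[]/eqP xE; move: sx; rewrite {}xE => sx.
  by rewrite tpermL (negPf sx) => /eqP.
by rewrite tpermR (negPf sx) orbF => /eqP.
Qed.

(** * The weight of a cycle *)

Section Cycle.
Variables (R : comNzRingType) (n : nat) (A : 'I_n -> 'I_n -> R) (t : seq 'I_n).
Hypotheses (t2 : (2 < size t)%N) (Ut : uniq t).

(** [next t] fixes every point off [t] and is undone by [prev t], so it is a permutation of all the
    vertices. *)
Let c : {perm 'I_n} := perm (can_inj (prev_next Ut)).

Let cE x : c x = next t x. Proof. exact: permE. Qed.

Let next_notin x : x \notin t -> next t x = x.
Proof. by move=> xt; rewrite next_nth (negPf xt). Qed.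

(** Length at least three makes the two directions differ at every vertex of the cycle. *)
Let next_next x : x \in t -> next t (next t x) != x.
Proof. exact: next_next_neq. Qed.

Let moved_c : moved c = [set x in t].
Proof.
apply/setP => x; rewrite !inE cE; have [xt|xt] := boolP (x \in t).
  by apply: contraNneq (next_next xt) => nx; rewrite !nx.
by rewrite next_notin // eqxx.
Qed.

Let perm_graph_c : perm_graph c = cycle_graph t.
Proof.
rewrite /perm_graph moved_c; congr (_, _); apply/setP => d.
by apply/imsetP/imsetP => -[x]; rewrite ?inE => xt ->; exists x;
  rewrite ?inE ?cE.
Qed.

(** [odd_perm] compares the parities of the number of points and the number of orbits. The orbits of
    [c] are [t] itself and one singleton for each point off [t]. *)
Let odd_c : odd_perm c = ~~ odd (size t).
Proof.
have orb x : porbit c x = if x \in t then [set y in t] else [set x].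
  apply/setP => y; apply/porbitP/idP => [[k ->]|].
    elim: k => [|k IH]; first by rewrite expg0 perm1; case: ifP; rewrite inE.
    rewrite expgSr permM cE; case: ifP IH => xt; rewrite !inE ?mem_next //.
    by move/eqP->; rewrite next_notin ?xt.
  case: ifP => xt; rewrite inE => yt; last first.
    by exists 0%N; rewrite expg0 perm1 (eqP yt).
  have C := connect_cycle (cycle_next Ut) xt yt.
  exists (findex (next t) x y); rewrite permX -{1}(iter_findex C).
  by apply: eq_iter => z; rewrite cE.
have [x0 x0t] : exists x, x \in t.
  by case: (t) t2 => // x q _; exists x; rewrite mem_head.
have E : porbits c = [set y in t] |: [set [set x] | x in ~: [set y in t]].
  apply/setP => X; rewrite in_setU1; apply/imsetP/orP.
    case=> x _ ->; rewrite orb; case: ifP => xt; first by left.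
    by right; apply: imset_f; rewrite !inE xt.
  case=> [/eqP->|/imsetP[x]]; first by exists x0; rewrite ?orb ?x0t.
  by rewrite !inE => xt ->; exists x; rewrite ?orb ?(negPf xt).
have ct : #|[set y in t]| = size t by rewrite cardsE; apply/card_uniqP.
rewrite /odd_perm E cardsU1 card_imset; last exact: set1_inj.
rewrite -(cardsC [set y in t]) ct oddD.
have -> : [set y in t] \notin [set [set x] | x in ~: [set y in t]].
  apply/imsetP => -[x]; rewrite !inE => xt /setP/(_ x); rewrite !inE eqxx.
  by rewrite (negPf xt).
by rewrite oddD /=; do 2!case: (odd _).
Qed.

(** At each vertex of the cycle such an [s] steps forward or backward. One forward step propagates
    around the whole cycle and gives [c]; if there is none, all steps go backward and [s] is the
    inverse of [c]. *)
Let perm_graph_eq s : (perm_graph s == cycle_graph t) = (s \in [set c; c^-1])%g.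
Proof.
rewrite !inE; apply/eqP/idP => [Es|/orP[]/eqP->]; rewrite ?perm_graphV //.
case: (Es) => Em Ee.
have alt x : x \in t -> (s x == next t x) || (next t (s x) == x).
  move=> xt; have: [set x; s x] \in [set [set v; next t v] | v in t].
    by rewrite -Ee; apply: imset_f; rewrite Em inE.
  case/imsetP => y yt E.
  have: x \in [set y; next t y] by rewrite -E set21.
  have: s x \in [set y; next t y] by rewrite -E set22.
  have sx : s x != x by have: x \in moved s; [rewrite Em inE | rewrite inE].
  rewrite !inE => /orP[]/eqP sxE /orP[]/eqP xE.
  - by rewrite sxE xE eqxx in sx.
  - by rewrite sxE -xE eqxx orbT.
  - by rewrite sxE xE eqxx.
  - by rewrite sxE -xE eqxx in sx.
have st x : x \in t -> s x \in t.
  by move=> xt; have := moved_perm s x; rewrite Em !inE xt.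
(* A permutation stepping forward once keeps going: a step back from
   [next t x] to [x] would leave the edge after [next t x] undrawn. *)
have step x : x \in t -> s x == next t x -> s (next t x) == next t (next t x).
  move=> xt /eqP sx; have nt : next t x \in t by rewrite mem_next.
  have /orP[//|/eqP/(can_inj (prev_next Ut)) snx] := alt _ nt.
  have nnt : next t (next t x) \in t by rewrite mem_next.
  have: [set next t x; next t (next t x)] \in [set [set v; s v] | v in moved s].
    by rewrite Ee; apply: imset_f.
  case/imsetP => z zs E; have: z \in [set next t x; next t (next t x)].
    by rewrite E set21.
  have: s z \in [set next t x; next t (next t x)] by rewrite E set22.
  rewrite !inE => szE /orP[]/eqP zE; move: szE; rewrite {}zE.
    by rewrite snx => /orP[/eqP xn|]; [have := next_next xt; rewrite -!xn eqxx
      | rewrite eq_sym (negPf (next_next xt))].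
  case/orP => [|/eqP sE].
    by rewrite -{2}sx (inj_eq perm_inj) (negPf (next_next xt)).
  have: next t (next t x) \in moved s by rewrite Em inE.
  by rewrite inE sE eqxx.
have outside p x : perm_graph p = cycle_graph t -> x \notin t -> p x = x.
  case=> pm _ xt; apply/eqP; apply: contraNT xt => px.
  by have: x \in moved p; [rewrite inE | rewrite pm inE].
have [/existsP[x0 /andP[x0t x0s]]|/existsPn no] :=
    boolP [exists x, (x \in t) && (s x == next t x)].
  apply/orP; left; apply/eqP/permP => y.
  have [yt|yt] := boolP (y \in t); last first.
    by rewrite !outside.
  have /connectP[p] := connect_cycle (cycle_next Ut) x0t yt; rewrite cE.
  elim: p x0 x0t x0s => [|z p IH] x xt sx /=; first by move=> _ ->; exact/eqP.
  by case/andP=> /eqP<-; apply: IH; rewrite ?mem_next ?step.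
apply/orP; right; apply/eqP/permP => y.
have [yt|yt] := boolP (y \in t); last first.
  by rewrite !outside ?perm_graphV.
(* With forward steps excluded, [alt] leaves only that [c] sends [s y] back to [y]. *)
apply: (@perm_inj _ c); rewrite permKV cE; apply/eqP.
by have /orP[sy|//] := alt y yt; have := no y; rewrite yt sy.
Qed.

(** The two directions give the two products. Both carry the sign of a cyclic permutation of length
    [size t] times [size t] minus signs, which is -1 for either parity. *)
Lemma graph_weight_cycle : graph_weight A (cycle_graph t) =
  - (\prod_(x <- t) A x (next t x) + \prod_(x <- t) A (next t x) x).
Proof.
(* Otherwise [c] would be an involution, and the sum over the two directions would have one term
   only. *)
have cV : c != c^-1%g.
  case: (t) t2 (next_next) (cE) => // x0 q _ nn cE'.
  apply: contraNneq (nn x0 (mem_head _ _)) => cV.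
  by rewrite -!cE' {1}cV permK.
have bt (F : 'I_n -> R) : \prod_(x in [set x in t]) F x = \prod_(x <- t) F x.
  by rewrite (eq_bigl (mem t)) ?big_uniq // => x; rewrite inE.
have sz : #|moved c| = size t by rewrite moved_c cardsE; apply/card_uniqP.
have sgn : (-1) ^+ c * (-1) ^+ #|moved c| = -1 :> R.
  by rewrite sz -[(-1) ^+ size t]signr_odd -signr_addb odd_c addNb addbb.
have mV : moved c^-1 = moved c by case: (perm_graphV c).
rewrite /graph_weight (eq_bigl _ _ perm_graph_eq) big_setU1 ?inE //= big_set1.
rewrite /perm_weight odd_permV mV !prodrN !mulrA sgn !mulN1r opprD moved_c.
congr (- _ - _); first by rewrite -bt; apply: eq_bigr => x _; rewrite cE.
(* Shifting the index by [c] turns the backward entry at [c x] into [A (next t x) x]. *)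
rewrite (reindex_inj (@perm_inj _ c)) /= -bt; apply: eq_big => x.
  by rewrite !inE cE mem_next.
by rewrite permK cE.
Qed.

End Cycle.

(** * Expansion of the characteristic polynomial *)

Lemma char_poly_perm_weight (R : comNzRingType) n (A : 'M[R]_n) :
    (forall i, A i i = 0) ->
  char_poly A = \sum_(s : 'S_n) perm_weight A s *: 'X^(n - #|moved s|).
Proof.
move=> A0; rewrite /char_poly /determinant; apply: eq_bigr => s _.
rewrite (bigID (mem (moved s))) /= /perm_weight -mul_polyC polyCM rmorph_sign.
rewrite -mulrA; congr (_ * (_ * _)).
  rewrite rmorph_prod /=; apply: eq_bigr => i; rewrite !inE => si.
  by rewrite !mxE eq_sym (negPf si) mulr0n add0r polyCN.
(* As the diagonal of [A] vanishes, each fixed point contributes exactly one factor ['X]. *)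
rewrite (eq_bigr (fun=> 'X)) => [|i]; last first.
  by rewrite !inE negbK => /eqP si; rewrite !mxE si A0 eqxx mulr1n subr0.
rewrite prodr_const; congr (_ ^+ _).
transitivity #|~: moved s|; first by apply: eq_card => i; rewrite [RHS]in_setC.
by rewrite cardsCs setCK card_ord.
Qed.

Lemma sum_even (V : nmodType) n (D : nat -> V) :
    (forall m, odd m -> D m = 0) ->
  \sum_(0 <= m < n.+1) D m = \sum_(0 <= k < n./2.+1) D (2 * k)%N.
Proof.
move=> D0; elim: n => [|n IH]; first by rewrite !big_nat1 muln0.
rewrite big_nat_recr //= IH uphalf_half.
(* The right-hand sum gains a term precisely when [n.+1] is even. *)
have [on|en] := boolP (odd n); last by rewrite add0n [D n.+1]D0 ?addr0.
rewrite add1n [RHS]big_nat_recr //=; congr (_ + D _).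
by rewrite mul2n doubleS -[in LHS](odd_double_half n) on add1n.
Qed.

(** * Weights for the adjacency matrix of a skew gain graph *)

Section SkewGain.
Variables (F : fieldType) (f : F -> F) (n : nat) (Phi : skew_gain_graph f n).
Local Notation A := (adjacency Phi).

Lemma adjacency_edge u v : edge Phi u v -> A u v = gain Phi u v.
Proof. by rewrite mxE => ->. Qed.

Lemma perm_weight_edge (s : 'S_n) : perm_weight A s != 0 ->
  {in moved s, forall x, edge Phi x (s x)}.
Proof.
rewrite mulf_eq0 signr_eq0 /= => /prodf_neq0 As x xs.
by have := As x xs; rewrite oppr_eq0 mxE; case: ifP; rewrite ?eqxx.
Qed.

(** [s] injects the moved points of each side into those of the other side, so both sides contain
    equally many. *)
Lemma bipartite_moved (s : 'S_n) : bipartite (edge Phi) ->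
  perm_weight A s != 0 -> ~~ odd #|moved s|.
Proof.
case=> side bip /perm_weight_edge es.
pose S b := moved s :&: [set x | side x == b].
have sub b : s @: S b \subset S (~~ b).
  apply/subsetP => _ /imsetP[x /setIP[xs xb] ->].
  move: xb; rewrite inE => /eqP xb; rewrite inE moved_perm xs inE -xb.
  by have := bip _ _ (es _ xs); case: (side x); case: (side _).
have le b : (#|S b| <= #|S (~~ b)|)%N.
  by rewrite -(card_imset _ (@perm_inj _ s)) subset_leq_card.
rewrite -(cardsID [set x | side x == true]).
have -> : moved s :\: [set x | side x == true] = S false.
  by apply/setP => x; rewrite !inE andbC; case: (side x).
have -> : #|S false| = #|S true| by apply/eqP; rewrite eqn_leq !le.
by rewrite oddD addbb.
Qed.

Lemma perm_graph_elementary (s : 'S_n) : perm_weight A s != 0 ->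
  perm_graph s \in elementary_subgraphs (edge Phi) #|moved s|.
Proof.
move=> /perm_weight_edge es; rewrite inE eqxx -andbA; apply/and3P; split=> //.
- exact: well_formed_perm_graph.
- apply/subsetP => _ /imsetP[x xs ->]; apply/imset2P.
  by exists x (s x); rewrite ?inE ?es.
- by apply/forall_inP => H; apply: perm_graph_components.
Qed.

(** Permutations whose graph is not elementary of order [m] have weight zero; the others are grouped
    by the graph that they draw. *)
Lemma sum_perm_weight m :
  \sum_(s : 'S_n | #|moved s| == m) perm_weight A s =
  \sum_(L in elementary_subgraphs (edge Phi) m) graph_weight A L.
Proof.
rewrite (bigID
  (fun s => perm_graph s \in elementary_subgraphs (edge Phi) m)) /=.
rewrite addrC big1 => [|s /andP[/eqP <-]]; last first.
  by apply: contraNeq => /perm_graph_elementary.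
rewrite add0r (partition_big (@perm_graph _)
  (mem (elementary_subgraphs (edge Phi) m))) => [|s /andP[]//].
apply: eq_bigr => L /= Lm; apply: eq_bigl => s.
apply/andP/idP => [[]//|/eqP sL]; rewrite sL Lm andbT; split=> //.
by move: Lm; rewrite -sL inE => /and3P[].
Qed.

Lemma K2_weight H : is_K2 H ->
    H.2 \subset [set [set u; v] | u in 'I_n, v in 'I_n & edge Phi u v] ->
  graph_weight A H = - norm_gain f (K2_gain Phi H).
Proof.
move=> HK /subsetP He; rewrite /K2_gain.
case: pickP => [[u v] /= /andP[uv /eqP HE]|no].
  have euv : edge Phi u v.
    by apply: edge_set2 (@edge_sym _ _ _ Phi) (He _ _); rewrite HE inE.
  have evu : edge Phi v u by rewrite edge_sym.
  by rewrite HE graph_weight_K2 // !adjacency_edge // (gain_rev euv).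
(* The default value 1 of [K2_gain] is never reached on a [K_2]. *)
by case/existsP: HK => u /existsP[v HE]; have := no (u, v); rewrite /= HE.
Qed.

(** Reversing every edge applies [f] to every gain, and [f] is multiplicative, so the backward
    product is [f] of the forward one. *)
Lemma cycle_weight H : anti_involution f -> is_cycle H ->
    H.2 \subset [set [set u; v] | u in 'I_n, v in 'I_n & edge Phi u v] ->
  graph_weight A H = - (cycle_gain Phi H + f (cycle_gain Phi H)).
Proof.
move=> fP HC /subsetP He; rewrite /cycle_gain.
case: pickP => [[t tH] /= tr|no]; last first.
  case/existsP: HC => t tr; have := no t; rewrite /= tr //.
have /and3P[t2 Ut /eqP HE] := tr; move: (t) t2 Ut HE => {tH tr}t t2 Ut HE.
have et v : v \in t -> edge Phi v (next t v).
  move=> vt; apply: edge_set2 (@edge_sym _ _ _ Phi) (He _ _).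
  by rewrite HE; apply: imset_f.
rewrite {1}HE graph_weight_cycle // /walk_gain.
rewrite -(anti_involution_prod fP) => [|v /et/gain_neq0 //].
congr (- (_ + _)); apply: eq_big_seq => v /et e.
  by rewrite adjacency_edge.
by rewrite adjacency_edge 1?edge_sym // (gain_rev e).
Qed.

Lemma elementary_weight m L : anti_involution f ->
    L \in elementary_subgraphs (edge Phi) m ->
  graph_weight A L = (-1) ^+ #|components L|
       * (\prod_(H in components L | is_K2 H) norm_gain f (K2_gain Phi H))
       * (\prod_(H in components L | is_cycle H)
            (cycle_gain Phi H + f (cycle_gain Phi H))).
Proof.
move=> fP; rewrite inE => /and3P[sL _ /forall_inP Lc].
rewrite -{1}(disjoint_union_components sL).
rewrite graph_weight_disjoint_union; last 2 first.
- by move=> H; apply: well_formed_components.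
- exact: components_disjoint.
(* All factors are gathered into one product over the components, each of which brings its own -1; a
   filtered-out factor becomes 1. *)
rewrite -prodr_const !big_mkcondr -!big_split /=; apply: eq_bigr => H HL.
have He := component_edges sL HL.
have [HK|HK] := boolP (is_K2 H).
  by rewrite is_K2_not_cycle // mulr1 mulN1r K2_weight.
have HC : is_cycle H by have := Lc H HL; rewrite (negPf HK).
by rewrite HC mulr1 mulN1r cycle_weight.
Qed.

End SkewGain.

Theorem theorem2p7 (F : fieldType) (charF0 : [pchar F] =i pred0)
    (f : F -> F) (fP : anti_involution f)
    (n : nat) (Phi : skew_gain_graph f n) (bip : bipartite (edge Phi)) :
  let a (m : nat) : F :=
    \sum_(L in elementary_subgraphs (edge Phi) m)
       (-1) ^+ #|components L|
       * (\prod_(H in components L | is_K2 H) norm_gain f (K2_gain Phi H))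
       * (\prod_(H in components L | is_cycle H)
            (cycle_gain Phi H + f (cycle_gain Phi H))) in
  char_poly (adjacency Phi)
    = 'X^n + \sum_(1 <= k < n./2.+1) a (2 * k)%N *: 'X^(n - 2 * k).
Proof.
move=> a.
(* The coefficient of ['X^(n - m)], as a sum over the permutations that move [m] points. *)
pose C (m : nat) :=
  \sum_(s : 'S_n | #|moved s| == m) perm_weight (adjacency Phi) s.
have CE m : C m = a m.
  rewrite /C sum_perm_weight; apply: eq_bigr => L.
  exact: elementary_weight.
have C0 : C 0%N = 1.
  rewrite /C -(graph_weight0 (adjacency Phi)); apply: eq_bigl => s.
  rewrite cards_eq0; apply/eqP/eqP => [s0|[]//].
  by rewrite /perm_graph s0 imset0.
have Codd m : odd m -> C m = 0.
  move=> om; apply: big1 => s /eqP sm; apply/eqP; apply: contraLR om.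
  by rewrite -sm; apply: bipartite_moved.
rewrite char_poly_perm_weight => [|i]; last by rewrite mxE edge_irr.
(* The bound makes the number of moved points an index in ['I_n.+1], by which the expansion is
   partitioned. *)
have lt_moved (s : 'S_n) : (#|moved s| < n.+1)%N.
  by rewrite ltnS -[X in (_ <= X)%N]card_ord max_card.
rewrite (partition_big (fun s => Ordinal (lt_moved s)) xpredT) //=.
transitivity (\sum_(0 <= m < n.+1) C m *: 'X^(n - m)).
  rewrite big_mkord; apply: eq_bigr => m _; rewrite /C scaler_suml.
  by apply: eq_bigr => s /eqP/(congr1 val) /= ->.
rewrite (@sum_even _ _ (fun m => C m *: 'X^(n - m))) => [|m /Codd ->];
  last exact: scale0r.
(* The term for 0 moved points is the leading ['X^n]. *)
rewrite (@big_ltn _ _ _ 0) // muln0 C0 scale1r subn0; congr (_ + _).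
by apply: eq_bigr => k _; rewrite CE.
Qed.
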